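(* Let $G$ be a finite simple graph and let $p$ and $q$ be two integer-valued functions on $V(G)$ with $p(v)<q(v)$ for every $v\in V(G)$, such that for each $v\in V(G)$, $q(v)\ge \frac{1}{2}d_G(v)$ and $p(v)\ge \frac{1}{2}q(v)-2$. Then $G$ admits an orientation $D$ with $p(v)\le d^+_D(v)\le q(v)$ for every $v\in V(G)$ if and only if $G$ admits an orientation $D'$ such that for each $v\in V(G)$, $$d^+_{D'}(v)\in\{p(v),\,p(v)+1,\,q(v)-1,\,q(v)\}.$$
   Context: A simple graph has neither loops nor multiple edges; $d_G(v)$ denotes the degree of $v$ in $G$. An orientation $D$ of $G$ assigns a direction to each edge; $d^+_D(v)$ denotes the out-degree of $v$ in $D$ (the number of edges directed away from $v$). *)

(* Defs.v *)
From mathcomp Require Import all_boot all_order all_algebra.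
Set Implicit Arguments.
Unset Strict Implicit.
Unset Printing Implicit Defensive.

Section Graphs.
Variables (V : finType) (e : rel V).

Definition simple_graph : Prop := symmetric e /\ irreflexive e.

Definition degree (v : V) : nat := #|[set w | e v w]|.

(* [D u v] means that the edge {u, v} is directed from u to v.  The first
   conjunct cannot be dropped: the second says nothing about non-edges. *)
Definition orientation (D : rel V) : Prop :=
  (forall u v, D u v -> e u v) /\
  (forall u v, e u v -> D u v = ~~ D v u).

End Graphs.

Definition outdegree (V : finType) (D : rel V) (v : V) : nat :=
  #|[set w | D v w]|.

(* Main.v *)
Require Import Defs.
From mathcomp Require Import all_boot all_order all_algebra.
From mathcomp Require Import zify.
From Stdlib Require Import Classical.
Import Order.TTheory GRing.Theory Num.Theory.

(** Call [v] bad when [p v + 2 <= d v <= q v - 2], with excess [d v - p v - 1],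
    and take an orientation with [p <= d <= q] of least total excess.  Reversing
    directed paths moves excess along reachability.  By induction on a set [S]
    that no arc leaves, every bad vertex reaches all of [S] (otherwise repair the
    smaller set it reaches); by minimality each vertex of [S] then has [d = q], or
    is in the middle, [p + 1 <= d <= q - 2].  All the excess can be gathered at
    any middle vertex [v], and as [v] still cannot be raised to [q v - 1] by
    borrowing one unit from other vertices, there is a set [A] containing [v] that
    few arcs enter, in the sense of a submodular function [cut].  Uncrossing gives
    a cover of the middle vertices by such sets [Y i], [i] in [I], with no [i] in
    another [Y j].  Off the cover [d = q >= deg / 2], so out-arcs balance in-arcs
    there, and counting the arcs that leave [I] contradicts [p >= q / 2 - 2]. *)

Set Implicit Arguments.
Unset Strict Implicit.
Unset Printing Implicit Defensive.

Local Open Scope nat_scope.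

(** * Extremal choice, and covers by minimizers of a submodular function *)

Lemma ex_min (T : Type) (K : T -> Prop) (f : T -> nat) :
  (exists x, K x) -> exists2 x, K x & forall y, K y -> f x <= f y.
Proof.
case=> x; move: {2}(f x).+1 (ltnSn (f x)) => n; elim: n x => // n IH x ltxn Kx.
have [[y [Ky ltyx]]|none] := classic (exists y, K y /\ f y < f x).
  by apply: IH Ky; lia.
by exists x => // y Ky; rewrite leqNgt; apply/negP=> ltyx; apply: none; exists y.
Qed.

Lemma ex_max (T : Type) (K : T -> Prop) (f : T -> nat) (N : nat) :
    (forall x, K x -> f x <= N) ->
  (exists x, K x) -> exists2 x, K x & forall y, K y -> f y <= f x.
Proof.
move=> fN /(ex_min (fun x => N - f x))[x Kx minx]; exists x => // y Ky.
by have := minx y Ky; have := fN y Ky; have := fN x Kx; lia.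
Qed.

(* The union of two overlapping minimizers is again a minimizer, so a minimizer
   of maximal cardinality through [w] absorbs those of all its points; hence a
   cover with the fewest sets has no redundant centre. *)
Lemma submodular_cover (V : finType) (b : {set V} -> nat) (M : {set V}) :
    (forall A B, b (A :&: B) + b (A :|: B) <= b A + b B) ->
  exists (Y : V -> {set V}) (I : {set V}),
    [/\ I \subset M, forall v, v \in Y v,
        forall v (A : {set V}), v \in A -> b (Y v) <= b A,
        forall v, v \in M -> exists2 i, i \in I & v \in Y i
      & forall i j, i \in I -> j \in I -> i \in Y j -> i = j].
Proof.
move=> bsub.
(* Lexicographic weight: first [b], then large cardinality. The second term is at most [#|V|], so it
   only breaks ties of [b]. *)
pose wt A := b A * #|V|.+1 + (#|V| - #|A|).
pose Y v := [arg min_(A < [set: V] | v \in A) wt A].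
have Yprop v : v \in Y v /\ forall A : {set V}, v \in A -> wt (Y v) <= wt A.
  by rewrite /Y; case: arg_minnP => [|A vA minA]; rewrite ?inE.
have Yv v : v \in Y v by case: (Yprop v).
have Ymin v (A : {set V}) : v \in A -> b (Y v) <= b A.
  move=> vA; have := (Yprop v).2 A vA; rewrite /wt => le.
  rewrite leqNgt; apply/negP => lt.
  have := max_card A; have := max_card (Y v); nia.
have Ysub v w : v \in Y w -> Y v \subset Y w.
  move=> vw; have bI : b (Y v) <= b (Y v :&: Y w) by apply: Ymin; rewrite inE Yv.
  have bU : b (Y v :|: Y w) <= b (Y w) by have := bsub (Y v) (Y w); lia.
  have := (Yprop w).2 (Y v :|: Y w); rewrite inE Yv orbT /wt => /(_ isT) le.
  have cU := subset_leq_card (subsetUr (Y v) (Y w)).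
  have mU := max_card (Y v :|: Y w).
  have -> : Y w = Y v :|: Y w.
    by apply/eqP; rewrite eqEcard subsetUr; nia.
  exact: subsetUl.
pose cov (I : {set V}) := (I \subset M) && (M \subset \bigcup_(i in I) Y i).
have covM : cov M.
  by rewrite /cov subxx; apply/subsetP=> v vM; apply/bigcupP; exists v.
case: (arg_minnP (fun I : {set V} => #|I|) covM) => I /andP[IM MI] minI.
exists Y, I; split=> //.
  by move=> v vM; have /bigcupP[i] := subsetP MI v vM; exists i.
move=> i j iI jI ij; apply/eqP; apply: contraT => neij.
have: cov (I :\ i).
  rewrite /cov (subset_trans (subsetDl _ _) IM).
  apply/subsetP=> v /(subsetP MI)/bigcupP[k kI vk]; apply/bigcupP.
  have [eki|neki] := eqVneq k i; last by exists k; rewrite // !inE neki.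
  exists j; first by rewrite !inE eq_sym neij.
  by apply: (subsetP (Ysub i j ij)); rewrite -eki.
by move=> /minI; rewrite (cardsD1 i I) iI; lia.
Qed.

(** * Orientations and arc counts between vertex sets *)

Section Orientations.

Variables (V : finType) (e : rel V).
Hypotheses (e_sym : symmetric e) (e_irr : irreflexive e).

Definition arcs (D : rel V) (A B : {set V}) : nat :=
  \sum_(x in A) \sum_(y in B) D x y.

Definition agree_off (S : {set V}) (D D' : rel V) : Prop :=
  forall x y, ~~ ((x \in S) && (y \in S)) -> D' x y = D x y.

Definition closed_out (D : rel V) (S : {set V}) : Prop :=
  forall x y, x \in S -> D x y -> y \in S.

Lemma outdegreeE (D : rel V) v : outdegree D v = \sum_y D v y.
Proof.
rewrite /outdegree -sum1_card big_mkcond; apply: eq_bigr => w _.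
by rewrite inE; case: (D v w).
Qed.

Lemma outdegree_closed (D : rel V) (S : {set V}) v :
  closed_out D S -> v \in S -> outdegree D v = \sum_(y in S) D v y.
Proof.
move=> clS vS; rewrite outdegreeE [RHS]big_mkcond; apply: eq_bigr => y _.
by case: ifPn => // yS; case Dvy: (D v y) => //; rewrite (clS _ _ vS Dvy) in yS.
Qed.

Lemma agree_off_closed (S : {set V}) (D D' : rel V) :
  agree_off S D D' -> closed_out D S -> closed_out D' S.
Proof.
move=> ag cl x y xS D'xy; apply: contraT => yS.
by rewrite -(negPf yS) (cl x) // -ag // (negPf yS) andbF.
Qed.

Lemma agree_off_trans (S R : {set V}) (D1 D2 D3 : rel V) :
  R \subset S -> agree_off S D1 D2 -> agree_off R D2 D3 -> agree_off S D1 D3.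
Proof.
move=> RS ag1 ag2 x y xyS; rewrite ag2 ?ag1 //; apply: contra xyS.
by case/andP=> xR yR; rewrite !(subsetP RS).
Qed.

Lemma agree_off_outdegree (S : {set V}) (D D' : rel V) v :
  agree_off S D D' -> v \notin S -> outdegree D' v = outdegree D v.
Proof.
by move=> ag vS; rewrite !outdegreeE; apply: eq_bigr => y _; rewrite ag // (negPf vS).
Qed.

Lemma orientation_add (D : rel V) x y : orientation e D -> D x y + D y x = e x y.
Proof.
case=> De Da; case exy: (e x y).
  by rewrite (Da _ _ exy); case: (D y x).
have /negPf-> : ~~ D x y by apply/negP=> /De; rewrite exy.
by have /negPf-> : ~~ D y x by apply/negP=> /De; rewrite e_sym exy.
Qed.

Lemma orientation_irr (D : rel V) x : orientation e D -> D x x = false.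
Proof. by move=> /(orientation_add x x); rewrite e_irr; case: (D x x). Qed.

Lemma arcs_exchange (D : rel V) A B :
  arcs D A B = \sum_(y in B) \sum_(x in A) D x y.
Proof. exact: exchange_big. Qed.

Lemma orientation_arcs (D : rel V) A B :
  orientation e D -> arcs D A B + arcs D B A = arcs e A B.
Proof.
move=> oD; rewrite (arcs_exchange D B A) -big_split; apply: eq_bigr => x _.
by rewrite -big_split; apply: eq_bigr => y _; exact: orientation_add.
Qed.

Lemma arcs_splitl (D : rel V) (A S B : {set V}) :
  A \subset S -> arcs D S B = arcs D A B + arcs D (S :\: A) B.
Proof. by move=> AS; rewrite /arcs (big_setID A) (setIidPr AS). Qed.

Lemma arcs_splitr (D : rel V) (A S B : {set V}) :
  A \subset S -> arcs D B S = arcs D B A + arcs D B (S :\: A).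
Proof.
move=> AS; rewrite -big_split; apply: eq_bigr => x _ /=.
by rewrite (big_setID A) (setIidPr AS).
Qed.

Lemma big_sub_mem (A S : {set V}) (F : V -> nat) :
  A \subset S -> \sum_(x in A) F x = \sum_(x in S) (x \in A) * F x.
Proof.
move=> AS; rewrite big_mkcond [RHS]big_mkcond; apply: eq_bigr => x _.
have [xA|xA] := boolP (x \in A); first by rewrite (subsetP AS) ?mul1n.
by rewrite mul0n if_same.
Qed.

Lemma arcs_sub (D : rel V) (A B S : {set V}) :
  A \subset S -> B \subset S ->
  arcs D A B = \sum_(x in S) \sum_(y in S) [&& x \in A, y \in B & D x y].
Proof.
move=> AS BS; rewrite /arcs (big_sub_mem _ AS); apply: eq_bigr => x _.
rewrite (big_sub_mem _ BS) big_distrr; apply: eq_bigr => y _ /=.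
by rewrite mulnb mulnb.
Qed.

Lemma sum_outdegree_closed (D : rel V) (S A : {set V}) :
  closed_out D S -> A \subset S ->
  \sum_(x in A) outdegree D x = arcs D A A + arcs D A (S :\: A).
Proof.
move=> cl AS; rewrite -arcs_splitr //.
by apply: eq_bigr => x xA; apply: outdegree_closed => //; apply: (subsetP AS).
Qed.

(** Each side counts the edges of the graph that lie in [S] and meet [A], a number independent of
    the orientation. *)
Lemma incident_invariant (D D' : rel V) (S A : {set V}) :
  orientation e D -> orientation e D' -> closed_out D S -> closed_out D' S ->
  A \subset S ->
  arcs D (S :\: A) A + \sum_(x in A) outdegree D x =
  arcs D' (S :\: A) A + \sum_(x in A) outdegree D' x.
Proof.
move=> oD oD' cD cD' AS; rewrite (sum_outdegree_closed cD AS) (sum_outdegree_closed cD' AS).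
have := orientation_arcs A A oD; have := orientation_arcs A A oD'.
by have := orientation_arcs A (S :\: A) oD; have := orientation_arcs A (S :\: A) oD'; lia.
Qed.

(** * Reversal of arcs and directed paths *)

Definition flip (D : rel V) (a c : V) : rel V := fun x y =>
  D x y (+) ((x == a) && (y == c) || (x == c) && (y == a)).

Lemma flip_orientation (D : rel V) a c :
  orientation e D -> D a c -> orientation e (flip D a c).
Proof.
case=> De Da Dac; have eac := De _ _ Dac.
split=> x y; rewrite /flip.
  case: (boolP (_ || _)) => [/orP[]/andP[/eqP-> /eqP->] _|_] //.
    by rewrite e_sym.
  by rewrite addbF; apply: De.
move=> exy; rewrite (Da x y exy) addNb; congr (~~ (_ (+) _)).
by rewrite orbC ![_ && (x == _)]andbC.
Qed.

Lemma flip_outdegree (D : rel V) a c u :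
  orientation e D -> D a c ->
  outdegree (flip D a c) u + (u == a) = outdegree D u + (u == c).
Proof.
move=> oD Dac; have [De Da] := oD; have eac := De _ _ Dac.
have Dca : D c a = false by rewrite Da ?Dac // e_sym.
have nac : (a == c) = false by apply/eqP=> eq; rewrite eq e_irr in eac.
(* Spreading each indicator over a sum with one nonzero term lets the identity be checked one vertex
   [y] at a time. *)
have sum1 (b : bool) (z : V) : nat_of_bool b = \sum_y (b && (y == z)).
  by rewrite (bigD1 z) //= eqxx andbT big1 ?addn0 // => y /negPf->; rewrite andbF.
rewrite !outdegreeE (sum1 (u == a) c) (sum1 (u == c) a) -!big_split.
apply: eq_bigr => y _ /=; rewrite /flip.
have [->|nua] := eqVneq u a; have [->|nyc] := eqVneq y c; rewrite ?nac ?Dac //=.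
- by case: (D a y).
- have [->|nuc] := eqVneq u c; have [eca|nya] := eqVneq c a; rewrite ?addbF ?addn0 //=.
  by rewrite eca eqxx in nac.
have [->|nuc] := eqVneq u c; have [->|nya] := eqVneq y a; rewrite ?Dca ?addbF ?addn0 //=.
Qed.

Lemma push_path (D : rel V) v w s :
    orientation e D -> path D v s -> last v s = w -> uniq (v :: s) -> v != w ->
  exists2 D' : rel V, orientation e D' &
    (forall x y, ~~ ((x \in v :: s) && (y \in v :: s)) -> D' x y = D x y) /\
    (forall u, outdegree D' u + (u == v) = outdegree D u + (u == w)).
Proof.
move=> oD; elim: s v => [|x s IH] v /=; first by move=> _ ->; rewrite eqxx.
case/andP=> Dvx pth lst /andP[vs us] nvw.
have [exw|nxw] := eqVneq x w.
  exists (flip D v x); first exact: flip_orientation.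
  split; last by move=> u; rewrite -exw flip_outdegree.
  move=> y z nyz; rewrite /flip; case: (boolP (_ || _)) => [fl|_]; last by rewrite addbF.
  by case/negP: nyz; case/orP: fl => /andP[/eqP-> /eqP->]; rewrite !inE !eqxx ?orbT.
have [D1 oD1 [ag1 deg1]] := IH x pth lst us nxw.
(* The tail of the path is reversed first. As the path is simple, [v] is not on the tail, so the arc
   from [v] to [x] is still there to be flipped. *)
have D1vx : D1 v x by rewrite ag1 // (negPf vs).
exists (flip D1 v x); first exact: flip_orientation.
split.
  move=> y z nyz; rewrite /flip; case: (boolP (_ || _)) => [fl|_].
    by case/negP: nyz; case/orP: fl => /andP[/eqP-> /eqP->]; rewrite !inE !eqxx ?orbT.
  rewrite addbF ag1 //; apply: contra nyz => /andP[ys zs].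
  by rewrite !(in_cons v) ys zs !orbT.
by move=> u; rewrite flip_outdegree // deg1.
Qed.

(** A path starting in a closed set never leaves it, so its reversal changes only arcs inside [S]
    and shifts one unit of out-degree from [v] to [w]. *)
Lemma push (D : rel V) (S : {set V}) v w :
    orientation e D -> closed_out D S -> v \in S -> connect D v w -> v != w ->
  exists D' : rel V, [/\ orientation e D', agree_off S D D',
    (outdegree D' v).+1 = outdegree D v,
    outdegree D' w = (outdegree D w).+1
  & forall u, u != v -> u != w -> outdegree D' u = outdegree D u].
Proof.
move=> oD clS vS /connectP[s pth lst] nvw.
case/shortenP: pth lst => t pth ut _ lst.
have [D' oD' [ag deg]] := push_path oD pth (esym lst) ut nvw.
exists D'; split=> //; last 3 first.
- by have := deg v; rewrite eqxx (negPf nvw) addn1 addn0.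
- by have := deg w; rewrite eqxx eq_sym (negPf nvw) addn1 addn0.
- by move=> u nuv nuw; have := deg u; rewrite (negPf nuv) (negPf nuw) !addn0.
move=> x y nxy; apply: ag; apply: contra nxy.
have tS z : z \in v :: t -> z \in S.
  move: {ut lst deg} vS; elim: t v pth {nvw} => [|a t IH] v /=.
    by move=> _ vS; rewrite inE => /eqP->.
  case/andP=> Dva pth vS; rewrite in_cons => /orP[/eqP->//|].
  by apply: IH => //; apply: clS Dva.
by case/andP=> /tS-> /tS->.
Qed.

Lemma connect_closed (D : rel V) (S : {set V}) v w :
  closed_out D S -> v \in S -> connect D v w -> w \in S.
Proof.
move=> clS vS /connectP[s pth ->]; elim: s v pth vS => //= x s IH v /andP[Dvx pth] vS.
by apply: IH => //; apply: clS Dvx.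
Qed.

(* Arcs from [i] into [Y i] are paid for by its vertices (simplicity of the
   graph), arcs from [i] into another [Y j] enter [Y j], and arcs from [i] to
   the rest [Z] of [S] are balanced by arcs leaving [Z], which enter some [Y j]. *)
Lemma cover_count (D : rel V) (S I : {set V}) (Y : V -> {set V}) :
    orientation e D -> closed_out D S -> I \subset S ->
    (forall i, i \in I -> i \in Y i) ->
    (forall i j, i \in I -> j \in I -> i \in Y j -> i = j) ->
    (forall z, z \in S -> (forall i, i \in I -> z \notin Y i) ->
       degree e z <= 2 * outdegree D z) ->
  \sum_(i in I) outdegree D i <=
  \sum_(i in I) (arcs D (S :\: Y i) (S :&: Y i) + #|(S :&: Y i) :\ i|).
Proof.
move=> oD clS IS Yi Yij hZ.
pose U := S :&: \bigcup_(i in I) Y i; pose Z := S :\: U.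
have US : U \subset S by apply: subsetIl.
have ZS : Z \subset S by apply: subsetDl.
have ZU x : x \in S -> (x \in U) = (x \notin Z) by move=> xS; rewrite [x \in Z]in_setD xS andbT negbK.
have IU i : i \in I -> i \in U.
  by move=> iI; rewrite inE (subsetP IS) //; apply/bigcupP; exists i; rewrite ?Yi.
have UZ : U = S :\: Z.
  by rewrite /Z setDDr setDv set0U (setIidPr US).
have bal : arcs D U Z <= arcs D Z U.
  (* Sum the degree hypothesis over [Z]; the arcs inside [Z] occur on both sides and cancel. *)
  have: arcs D S Z <= arcs D Z S.
    rewrite arcs_exchange; apply: leq_sum => z zZ.
    have zS := subsetP ZS z zZ.
    have degz : degree e z <= 2 * outdegree D z.
      apply: hZ => // i iI; apply/negP=> zi; move: zZ; rewrite !inE zS !andbT /=.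
      by case/negP; apply/bigcupP; exists i.
    rewrite -(outdegree_closed clS zS).
    have : degree e z = \sum_y e z y by exact: (outdegreeE e z).
    have -> : \sum_y e z y = outdegree D z + \sum_y D y z.
      rewrite outdegreeE -big_split; apply: eq_bigr => y _.
      by rewrite -(orientation_add z y oD).
    have : \sum_(x in S) D x z <= \sum_y D y z.
      by rewrite big_mkcond; apply: leq_sum => y _; case: ifP.
    by lia.
  by rewrite (arcs_splitl D Z ZS) (arcs_splitr D Z ZS) -UZ; lia.
pose far i y := [&& y \in U, y \notin Y i & D i y].
have out_le i : i \in I -> outdegree D i <=
    #|(S :&: Y i) :\ i| + \sum_(y in S) far i y + \sum_(y in Z) D i y.
  move=> iI; rewrite (outdegree_closed clS (subsetP IS i iI)) -sum1_card.
  have sub : S :&: Y i :\ i \subset S by rewrite subDset subsetU // subsetIl orbT.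
  rewrite (big_sub_mem _ sub) (big_sub_mem _ ZS).
  rewrite -!big_split; apply: leq_sum => y yS /=; rewrite /far ZU // !inE yS.
  have [->|ny] := eqVneq y i; first by rewrite (orientation_irr _ oD).
  by case: (y \in Y i); case: (D i y); case: (y \in \bigcup_(_ in _) _).
(* Each arc counted on the left, from [x] to [y], is charged to one [Y j] with [y] inside and [x]
   outside. No arc is counted twice, since [I] and [Z] are disjoint. *)
have far_le : \sum_(i in I) \sum_(y in S) far i y + arcs D Z U <=
    \sum_(i in I) arcs D (S :\: Y i) (S :&: Y i).
  rewrite (big_sub_mem _ IS) (arcs_sub D ZS US).
  under [leqRHS]eq_bigr => i _ do rewrite (arcs_sub D (subsetDl S (Y i)) (subsetIl S (Y i))).
  rewrite -big_split exchange_big; apply: leq_sum => x xS /=.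
  rewrite exchange_big big_distrr -big_split; apply: leq_sum => y yS /=.
  rewrite /far; case: (D x y); last by rewrite !andbF !muln0.
  rewrite !andbT.
  have [yU|_] := boolP (y \in U); last by rewrite !andbF muln0.
  have /setIP[_ /bigcupP[j jI yj]] := yU.
  have [xI|xI] := boolP (x \in I).
    have -> : (x \in Z) = false by apply/negbTE; rewrite -ZU ?IU.
    have [|yx] := boolP (y \in Y x) => //=.
    (* Otherwise [x = j], and then [y] would lie in [Y x]. *)
    have xj : x \notin Y j by apply/negP=> /(Yij _ _ xI jI) eq; rewrite eq yj in yx.
    by rewrite (bigD1 j) //= !inE xS yS xj yj.
  have [xZ|//] := boolP (x \in Z).
  have xj : x \notin Y j.
    apply/negP=> xj; move: xZ; rewrite !inE xS andbT /=.
    by case/negP; apply/bigcupP; exists j.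
  by rewrite (bigD1 j) //= !inE xS yS xj yj.
have: \sum_(i in I) outdegree D i <= \sum_(i in I) #|(S :&: Y i) :\ i|
    + \sum_(i in I) \sum_(y in S) far i y + arcs D I Z.
  by rewrite -!big_split; apply: leq_sum.
have : arcs D I Z <= arcs D U Z.
  rewrite /arcs (big_sub_mem _ (introT subsetP IU)).
  by apply: leq_sum => x _; case: (x \in I); rewrite ?mul1n.
by rewrite big_split /=; lia.
Qed.

(** * Feasibility, bad vertices and excess *)

Variables P q : V -> nat.
Hypotheses (deg_le : forall v, degree e v <= 2 * q v)
  (q_le : forall v, q v <= 2 * P v) (P_le : forall v, P v <= (q v).+1).

(* [P] stands for [p + 2], which is nonnegative; thus [bad] reads
   [p + 2 <= d <= q - 2], the complement of the four allowed values. *)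
Definition feasible (D : rel V) u :=
  P u <= outdegree D u + 2 /\ outdegree D u <= q u.

Definition bad (D : rel V) u :=
  (P u <= outdegree D u) && (outdegree D u + 2 <= q u).

(** With [d] the out-degree, the second branch is [d - p - 1], truncated to 0 at [d = p]; the first
    branch covers [d = q - 1] and [d = q]. *)
Definition excess (D : rel V) u :=
  if q u <= (outdegree D u).+1 then 0 else (outdegree D u).+1 - P u.

Definition total_excess (S : {set V}) (D : rel V) := \sum_(u in S) excess D u.

Lemma bad_excess D u : bad D u = (0 < excess D u).
Proof. by rewrite /bad /excess; case: ifP; lia. Qed.

Lemma total_excess_push (S : {set V}) (D D' : rel V) v w :
    v \in S -> w \in S -> v != w ->
    (forall u, u != v -> u != w -> outdegree D' u = outdegree D u) ->
  total_excess S D' + (excess D v + excess D w) =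
  total_excess S D + (excess D' v + excess D' w).
Proof.
move=> vS wS nvw eqd; rewrite /total_excess.
rewrite (bigD1 v) // (bigD1 w) /=; last by rewrite wS eq_sym.
rewrite [\sum_(u in S) excess D u](bigD1 v) //.
rewrite [\sum_(u in S | _) excess D u](bigD1 w) /=; last by rewrite wS eq_sym.
rewrite (eq_bigr (excess D)); first by lia.
by move=> u /andP[/andP[_ nuv] nuw]; rewrite /excess eqd.
Qed.

(** * Orientations of least total excess on a closed set *)

Section Extremal.

Variables (S : {set V}) (D0 : rel V).
Hypothesis closed_S : closed_out D0 S.

Definition admissible (D : rel V) :=
  [/\ orientation e D, agree_off S D0 D & forall u, u \in S -> feasible D u].

Definition extremal (D : rel V) :=
  admissible D /\ forall D', admissible D' -> total_excess S D <= total_excess S D'.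

(** This hypothesis and the next describe a failing induction step of [closed_orientation];
    [extremal_false] refutes them together. *)
Hypothesis some_bad : forall D, admissible D -> exists2 u, u \in S & bad D u.
Hypothesis bad_reaches : forall D v w,
  extremal D -> v \in S -> bad D v -> w \in S -> connect D v w.

Lemma admissible_closed D : admissible D -> closed_out D S.
Proof. by case=> _ ag _; apply: agree_off_closed ag closed_S. Qed.

(** A unit pushed from [v] to [w] lowers the excess at [v] by one, so by minimality it raises that
    at [w]. This forces the out-degree of [w] into the range from [p + 1] to [q - 3], and the total
    is unchanged. *)
Lemma push_bad D v w :
    extremal D -> v \in S -> bad D v -> w \in S -> v != w ->
  outdegree D w = q w \/
  [/\ P w <= (outdegree D w).+1, outdegree D w + 3 <= q w &
      exists D' : rel V, [/\ extremal D', (outdegree D' v).+1 = outdegree D v,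
        outdegree D' w = (outdegree D w).+1
      & forall u, u != v -> u != w -> outdegree D' u = outdegree D u]].
Proof.
move=> extD vS bv wS nvw; have [adD minD] := extD; have [oD agD feD] := adD.
have [eqw|neqw] := eqVneq (outdegree D w) (q w); [by left | right].
have cl := admissible_closed adD.
have [D' [oD' agD' dv dw du]] := push oD cl vS (bad_reaches extD vS bv wS) nvw.
have adD' : admissible D'.
  split=> //; first exact: agree_off_trans agD agD'.
  move=> u uS; have := feD u uS; rewrite /feasible.
  have [->|nuv] := eqVneq u v; first by move: bv; rewrite /bad; lia.
  have [->|nuw] := eqVneq u w; first by rewrite dw; lia.
  by rewrite du.
have := total_excess_push vS wS nvw du; have := minD _ adD'.
have := feD w wS; rewrite /feasible; move: bv; rewrite bad_excess.
have exv : 0 < excess D v -> excess D' v = (excess D v).-1.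
  by rewrite /excess; do 2!case: ifP; lia.
move=> bv; rewrite (exv bv) => few minle eqT.
have [Pw qw] : P w <= (outdegree D w).+1 /\ outdegree D w + 3 <= q w.
  have : excess D w < excess D' w by lia.
  by rewrite /excess dw; do 2!case: ifP; lia.
have exw : excess D' w = (excess D w).+1.
  by rewrite /excess dw; do 2!case: ifP; lia.
by split=> //; exists D'; split=> //; split=> // D2 /minD; lia.
Qed.

Variable D : rel V.
Hypothesis extD : extremal D.

Let adD : admissible D := extD.1.

(** * Middle vertices and the cut function *)

Definition middle := [set u in S | outdegree D u != q u].

Lemma middleP u : reflect (u \in S /\ outdegree D u <> q u) (u \in middle).
Proof. by rewrite inE; apply: (iffP andP) => -[uS /eqP]. Qed.

Lemma middle_bounds u : u \in middle ->
  P u <= (outdegree D u).+1 /\ outdegree D u + 2 <= q u.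
Proof.
case/middleP=> uS nq; have [v vS bv] := some_bad adD.
have [eq|nvu] := eqVneq v u; first by move: bv; rewrite eq /bad; lia.
by have [//|[]] := push_bad extD vS bv uS nvu; lia.
Qed.

(** How far the out-degree of [u] lies above the value it is lowered to in [middle_cut]: [p] for a
    middle vertex, [q - 1] for one at [q]. *)
Definition slack u :=
  if outdegree D u == q u then 1 else outdegree D u + 2 - P u.

Lemma slack_gt0 u : u \in S -> 0 < slack u.
Proof.
rewrite /slack; case: ifPn => // nq uS.
have /middle_bounds : u \in middle by rewrite inE uS nq.
by lia.
Qed.

Lemma slackM u : u \in middle -> slack u = outdegree D u + 2 - P u.
Proof. by rewrite /slack => /middleP[_ /eqP/negPf->]. Qed.

(** Indicators summed over [S] reduce submodularity to a check per vertex and per pair; [cutE] gives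
    the usual form. *)
Definition cut (A : {set V}) :=
  \sum_(x in S) ((x \in A) * slack x
    + \sum_(y in S) [&& x \notin A, y \in A & D x y]).

Lemma cutE (A : {set V}) : A \subset S ->
  cut A = arcs D (S :\: A) A + \sum_(x in A) slack x.
Proof.
move=> AS; rewrite /cut big_split -big_sub_mem //= addnC; congr (_ + _).
rewrite (arcs_sub _ (subsetDl S A) AS); apply: eq_bigr => x xS.
by apply: eq_bigr => y yS; rewrite !inE xS andbT.
Qed.

Lemma cut_setI (A : {set V}) : cut A = cut (S :&: A).
Proof.
apply: eq_bigr => x xS; rewrite inE xS; congr (_ + _).
by apply: eq_bigr => y yS; rewrite inE yS.
Qed.

Lemma cut_submodular (A B : {set V}) :
  cut (A :&: B) + cut (A :|: B) <= cut A + cut B.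
Proof.
rewrite /cut -!big_split; apply: leq_sum => x xS /=.
rewrite addnACA [leqRHS]addnACA leq_add //.
  by rewrite !inE; case: (x \in A); case: (x \in B); lia.
rewrite -!big_split; apply: leq_sum => y yS /=; rewrite !inE.
by case: (x \in A); case: (x \in B); case: (y \in A); case: (y \in B); case: (D x y).
Qed.

(* Since the excess flows freely inside [S], all of it can be gathered at [v]. *)
Lemma gather v : v \in middle ->
  exists D1 : rel V, [/\ admissible D1, outdegree D1 v + 2 <= q v,
    forall u, u \in S -> u \notin middle -> outdegree D1 u = q u
  & forall u, u \in middle -> u != v -> (outdegree D1 u).+1 = P u].
Proof.
move=> vM; have [vS _] := middleP _ vM.
pose K D1 := [/\ extremal D1,
  forall u, u \in S -> u \notin middle -> outdegree D1 u = q u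
  & forall u, u \in middle -> P u <= (outdegree D1 u).+1 /\ outdegree D1 u + 2 <= q u].
have KD : K D.
  split=> // [u uS|u]; last exact: middle_bounds.
  by rewrite inE uS /= negbK => /eqP.
have [D1 [ext1 Q1 M1] max1] : exists2 D1, K D1 &
    forall D2, K D2 -> outdegree D2 v <= outdegree D1 v.
  apply: (ex_max (N := q v)); last by exists D.
  by move=> D1 [_ _ /(_ v vM)]; lia.
exists D1; split=> //; [exact: ext1.1 | by have := M1 v vM; lia |].
move=> u uM nuv; have [Pu qu] := M1 u uM; have [uS _] := middleP _ uM.
apply/eqP; apply: contraT => nP.
(* Such a [u] is above [p + 1], hence bad, and a unit pushed from it to [v] would stay in [K] and
   raise [v]. *)
have bu : bad D1 u by rewrite /bad; lia.
have [|[Pv qv [D2 [ext2 d2u d2v d2]]]] := push_bad ext1 uS bu vS nuv.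
  by have := M1 v vM; lia.
have /max1 : K D2; last by lia.
split=> // w.
  move=> wS wM; rewrite d2 ?Q1 //; apply: contraNneq wM => -> //.
move=> wM; have [->|nwu] := eqVneq w u; first by move: bu; rewrite /bad; lia.
have [->|nwv] := eqVneq w v; first by lia.
by rewrite d2 //; apply: M1.
Qed.

(** After gathering at [v], let every other vertex of [S] give up at most one unit and raise [v] as
    far as possible. The set [A] of vertices that still reach [v] has no entering arc and nothing
    left to give. *)
Lemma middle_cut v : v \in middle ->
  exists2 A : {set V}, v \in A & cut A + P v <= q v.
Proof.
move=> vM; have [vS _] := middleP _ vM; have [oD agD feD] := adD.
have [D1 [[o1 ag1 fe1] d1v Q1 M1]] := gather vM.
pose K D2 := [/\ orientation e D2, agree_off S D0 D2, feasible D2 v,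
  forall u, u \in S -> u \notin middle ->
    outdegree D2 u = q u \/ (outdegree D2 u).+1 = q u
  & forall u, u \in middle -> u != v ->
    (outdegree D2 u).+1 = P u \/ outdegree D2 u + 2 = P u].
have KD1 : K D1.
  by split=> // [|u uS uM|u uM nuv]; [exact: fe1 | left; apply: Q1 | left; apply: M1].
have [D2 [o2 ag2 fe2 Q2 M2] max2] : exists2 D2, K D2 &
    forall D3, K D3 -> outdegree D3 v <= outdegree D2 v.
  by apply: (ex_max (N := q v)); [move=> D2 [_ _ []] | exists D1].
have nbad u : u \in S -> u != v -> feasible D2 u /\ ~~ bad D2 u.
  move=> uS nuv; rewrite /feasible /bad; have := P_le u.
  have [uM|uM] := boolP (u \in middle).
    by have := M2 u uM nuv; have := middle_bounds uM; lia.
  by have := Q2 u uS uM; lia.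
(* No other vertex of [S] is bad in [D2], so the bad vertex given by [some_bad] is [v]. *)
have d2v : outdegree D2 v + 2 <= q v.
  have ad2 : admissible D2.
    by split=> // u uS; have [->|/(nbad u uS)[]] := eqVneq u v.
  have [u uS bu] := some_bad ad2; move: (bu).
  have [->|nuv] := eqVneq u v; first by rewrite /bad; lia.
  by rewrite (negPf (nbad u uS nuv).2).
have cl2 : closed_out D2 S by apply: agree_off_closed ag2 closed_S.
pose A := [set u in S | connect D2 u v].
have AS : A \subset S by apply/subsetP=> u; rewrite inE => /andP[].
have vA : v \in A by rewrite inE vS connect0.
have low u : u \in A -> u != v -> outdegree D2 u +
    slack u = outdegree D u.
  rewrite inE => /andP[uS uv] nuv.
  have [D3 [o3 ag3 d3u d3v d3]] := push o2 cl2 uS uv nuv.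
  (* If [u] were at the higher of its two permitted values, pushing a unit to [v] would stay in [K],
     against the maximality of [D2]. *)
  have nK : ~ K D3 by move/max2; lia.
  have K3 : (u \in middle -> outdegree D3 u + 2 = P u) ->
      (u \notin middle -> (outdegree D3 u).+1 = q u) -> False.
    move=> hM hQ; apply: nK; split=> //; first exact: agree_off_trans ag2 ag3.
    - by move: fe2 d2v; rewrite /feasible; lia.
    - move=> w wS wM; have [eq|nwu] := eqVneq w u.
        by right; rewrite eq hQ // -eq.
      by rewrite d3 //; [apply: Q2 | apply: contraNneq wM => ->].
    move=> w wM nwv; have [eq|nwu] := eqVneq w u; last by rewrite d3 //; apply: M2.
    by right; rewrite eq hM // -eq.
  have [uM|uM] := boolP (u \in middle).
    rewrite slackM //; have := middle_bounds uM.
    have [d2u|] := M2 u uM nuv; last by lia.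
    by case: K3; [lia | rewrite uM].
  have := uM; rewrite inE uS negbK /= => eqq; rewrite /slack eqq; move/eqP: eqq.
  have [d2u|] := Q2 u uS uM; last by lia.
  by case: K3; [rewrite (negPf uM) | lia].
exists A => //; rewrite cutE //.
have noin : arcs D2 (S :\: A) A = 0.
  apply: big1 => x /setDP[xS xA]; apply: big1 => y.
  rewrite inE => /andP[_ yv]; case Dxy: (D2 x y) => //; case/negP: xA.
  by rewrite inE xS; apply: connect_trans (connect1 Dxy) yv.
(* Comparing [D] with [D2] on [A] turns the slacks of the other vertices into
   [outdegree D2 v - outdegree D v], so [cut A + P v] is [outdegree D2 v + 2]. *)
have := incident_invariant oD o2 (admissible_closed adD) cl2 AS.
rewrite noin add0n [\sum_(x in A) outdegree D x](bigD1 v) //.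
rewrite [\sum_(x in A) outdegree D2 x](bigD1 v) // [X in _ + X + _](bigD1 v) //=.
have -> : \sum_(i in A | i != v) outdegree D i =
   \sum_(i in A | i != v) outdegree D2 i + \sum_(i in A | i != v)
    slack i.
  by rewrite -big_split; apply: eq_bigr => u /andP[uA nuv]; rewrite /= low.
by rewrite slackM //; have := middle_bounds vM; lia.
Qed.

(** * Contradiction by counting over the cover *)

Lemma extremal_false : False.
Proof.
have [oD agD feD] := adD; have clD := admissible_closed adD.
have [Y [I [IM Yv Ymin cov Yij]]] := submodular_cover middle cut_submodular.
have IS : I \subset S by apply: subset_trans IM _; apply/subsetP=> u /middleP[].
have count : \sum_(i in I) outdegree D i <=
    \sum_(i in I) (arcs D (S :\: Y i) (S :&: Y i) + #|(S :&: Y i) :\ i|).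
  apply: cover_count => // z zS zY.
  have [/cov[i iI zi]|] := boolP (z \in middle); first by case/negP: (zY i iI).
  by rewrite inE zS negbK => /eqP->.
(* [Y i] has the least cut among sets through [i], so it inherits the bound of [middle_cut]; there
   [slack i + P i] is [outdegree D i + 2]. *)
have le_cut i : i \in I -> arcs D (S :\: Y i) (S :&: Y i) +
    \sum_(x in S :&: Y i | x != i) slack x
    + outdegree D i + 2 <= q i.
  move=> iI; have iM := subsetP IM i iI; have [A iA] := middle_cut iM.
  have := Ymin i A iA; rewrite [cut (Y i)]cut_setI cutE ?subsetIl //.
  rewrite (_ : S :\: (S :&: Y i) = S :\: Y i); last by rewrite setDIr setDv set0U.
  have iSY : i \in S :&: Y i by rewrite inE Yv (subsetP IS).
  rewrite [X in _ + X](bigD1 i) //= slackM //.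
  have := middle_bounds iM; lia.
have card_sum i : #|(S :&: Y i) :\ i| = \sum_(x in S :&: Y i | x != i) 1.
  by rewrite -sum1_card; apply: eq_bigl => x; rewrite !inE andbC.
have card_le i : #|(S :&: Y i) :\ i| <= \sum_(x in S :&: Y i | x != i) slack x.
  by rewrite card_sum; apply: leq_sum => x /andP[/setIP[xS _] _]; exact: slack_gt0.
(* Here [q <= 2 * P] and [P <= d + 1] give [q - d - 2 <= d]. *)
have le_out i : i \in I ->
    arcs D (S :\: Y i) (S :&: Y i) + #|(S :&: Y i) :\ i| <= outdegree D i.
  move=> iI; have := middle_bounds (subsetP IM i iI).
  by have := le_cut i iI; have := card_le i; have := q_le i; lia.
have [v0 v0S bv0] := some_bad adD.
have v0M : v0 \in middle by rewrite inE v0S; move: bv0; rewrite /bad; lia.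
have [i0 i0I v0i0] := cov v0 v0M.
(* A bad vertex makes one inequality strict: if it is [i0], then [P <= d] there; otherwise its slack
   is at least 2 while it counts only 1 in the cardinality. *)
have lt_out : arcs D (S :\: Y i0) (S :&: Y i0) + #|(S :&: Y i0) :\ i0| < outdegree D i0.
  have := middle_bounds (subsetP IM i0 i0I); have := le_cut i0 i0I; have := q_le i0.
  have := card_le i0; have [<-|nv0] := eqVneq v0 i0.
    by move: bv0; rewrite /bad; lia.
  have v0SY : (v0 \in S :&: Y i0) && (v0 != i0) by rewrite inE v0S v0i0.
  suff : #|(S :&: Y i0) :\ i0| < \sum_(x in S :&: Y i0 | x != i0) slack x by lia.
  rewrite card_sum (bigD1 v0) // [ltnRHS](bigD1 v0) //=.
  have : 1 < slack v0 by rewrite slackM //; move: bv0; rewrite /bad; lia.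
  suff : \sum_(i | (i \in S :&: Y i0) && (i != i0) && (i != v0)) 1 <=
      \sum_(i | (i \in S :&: Y i0) && (i != i0) && (i != v0)) slack i by lia.
  by apply: leq_sum => x /andP[/andP[/setIP[xS _] _] _]; exact: slack_gt0.
suff : \sum_(i in I) (arcs D (S :\: Y i) (S :&: Y i) + #|(S :&: Y i) :\ i|) <
    \sum_(i in I) outdegree D i by rewrite ltnNge count.
rewrite (bigD1 i0) // [ltnRHS](bigD1 i0) //= -addSn leq_add //.
by apply: leq_sum => i /andP[iI _]; exact: le_out.
Qed.

End Extremal.

(** * Induction on closed sets *)

Lemma closed_orientation (S : {set V}) (D0 : rel V) :
    orientation e D0 -> closed_out D0 S -> (forall u, u \in S -> feasible D0 u) ->
  exists2 D, admissible S D0 D & forall u, u \in S -> ~~ bad D u.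
Proof.
have [n] := ubnP #|S|; elim: n S D0 => // n IH S D0 ltSn o0 cl0 fe0.
apply: NNPP => none.
have some_bad D : admissible S D0 D -> exists2 u, u \in S & bad D u.
  move=> adD; apply: NNPP => nobad; apply: none; exists D => // u uS.
  by apply/negP=> bu; apply: nobad; exists u.
have [D adD minD] : exists2 D, admissible S D0 D &
    forall D', admissible S D0 D' -> total_excess S D <= total_excess S D'.
  by apply: ex_min; exists D0.
apply: (extremal_false cl0 some_bad _ (conj adD minD)) => {adD minD}D v w extD vS bv wS.
have [adD minD] := extD; have [oD agD feD] := adD.
have clD : closed_out D S by apply: agree_off_closed agD cl0.
(* If [v] misses [w], then [R] is a smaller closed set. Repairing it by induction keeps the
   out-degrees outside [R] and removes the excess of [v], against minimality. *)
pose R := [set u | connect D v u].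
have RS : R \subset S.
  by apply/subsetP=> u; rewrite inE; apply: connect_closed clD vS.
have vR : v \in R by rewrite inE connect0.
apply: contraT => nvw.
have ltRS : #|R| < #|S|.
  by apply/proper_card/properP; split=> //; exists w; rewrite // inE.
have clR : closed_out D R.
  by move=> x y; rewrite !inE => vx Dxy; apply: connect_trans vx (connect1 Dxy).
have [||D' [oD' agD' feD'] good] := IH R D _ oD clR; first by lia.
  by move=> u uR; apply: feD; apply: (subsetP RS).
have out u : u \notin R -> outdegree D' u = outdegree D u.
  exact: agree_off_outdegree agD'.
have /minD : admissible S D0 D'.
  split=> //; first exact: agree_off_trans agD agD'.
  move=> u uS; have [/feD'//|uR] := boolP (u \in R).
  by have := feD u uS; rewrite /feasible out.
rewrite leqNgt; case/negP; rewrite /total_excess (bigD1 v) // [ltnRHS](bigD1 v) //=.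
have ex0 u : u \in R -> excess D' u = 0.
  by move=> /good; rewrite bad_excess lt0n negbK => /eqP.
rewrite ex0 // add0n -add1n leq_add -?bad_excess //.
apply: leq_sum => u _; have [/ex0->//|uR] := boolP (u \in R).
by rewrite /excess out.
Qed.

End Orientations.

(** * Passage from integer bounds to natural numbers *)

Local Open Scope ring_scope.

Theorem theorem2p1 (V : finType) (e : rel V) (p q : V -> int)
  (hG : simple_graph e)
  (hpq : forall v : V, p v < q v)
  (hq : forall v : V, (degree e v)%:R / 2 <= (q v)%:~R :> rat)
  (hp : forall v : V, (q v)%:~R / 2 - 2 <= (p v)%:~R :> rat) :
  (exists D : rel V, orientation e D /\
     forall v : V, p v <= (outdegree D v)%:Z <= q v)
  <->
  (exists D' : rel V, orientation e D' /\
     forall v : V,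
       (outdegree D' v)%:Z \in [:: p v; p v + 1; q v - 1; q v]).
Proof.
have [e_sym e_irr] := hG.
have hq' v : (degree e v)%:Z <= 2 * q v.
  have := hq v; rewrite ler_pdivrMr // -[2]/(2%:~R) -intrM pmulrn ler_int; lia.
have hp' v : q v <= 2 * p v + 4.
  have := hp v; rewrite lerBlDr ler_pdivrMr // -[2]/(2%:~R) -intrD -intrM ler_int; lia.
split=> [[D [oD hD]]|[D [oD hD]]]; last first.
  exists D; split=> // v; have := hD v; have := hpq v; rewrite !inE; lia.
(* Since [0 <= degree e v <= 2 * q v] and [q v <= 2 * p v + 4], both arguments are nonnegative and
   [absz] keeps their values. *)
pose P v := absz (p v + 2); pose Q v := absz (q v).
have PE v : (P v)%:Z = p v + 2 by rewrite /P; have := hp' v; have := hq' v; lia.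
have QE v : (Q v)%:Z = q v by rewrite /Q; have := hq' v; lia.
have degQ v : (degree e v <= 2 * Q v)%N by have := hq' v; have := QE v; lia.
have QP v : (Q v <= 2 * P v)%N by have := hp' v; have := QE v; have := PE v; lia.
have PQ v : (P v <= (Q v).+1)%N by have := hpq v; have := QE v; have := PE v; lia.
have feD v : v \in [set: V] -> feasible P Q D v.
  by move=> _; have := hD v; have := QE v; have := PE v; rewrite /feasible; lia.
have clD : closed_out D [set: V] by [].
have [D' [oD' _ feD'] good] := closed_orientation e_sym e_irr degQ QP PQ oD clD feD.
exists D'; split=> // v; have := feD' v (in_setT v); have := good v (in_setT v).
by have := QE v; have := PE v; rewrite /feasible /bad !inE; lia.
Qed.
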